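(* Assume that the Bateman--Horn heuristic for pairs of polynomials, together with K. Conrad's generalization to integer-valued polynomials with rational coefficients (statement (BH) in the context), holds. Let $k\ge 3$ be an integer, let $D\ge 1$ be a square-free integer, let $\rho_0$ be a real number with $1<\rho_0<2$, and let $(r_0,t_0,y_0)$ be a complete polynomial family for $(k,D)$, with associated polynomial $p_0=\frac14(t_0^2+Dy_0^2)$. Let $F(x)$ be the number of triples belonging to the family with $r\le x$ and $p\le r^{\rho_0}$, and let $$E(x)=\frac{e(k,D)\,w_D}{2\rho_0 h_D}\int_2^x\frac{du}{u^{2-\rho_0}(\log u)^2}.$$ (i) Suppose that $\rho_0<1+\frac{1}{\deg r_0}$. Then the family asymptotically contains more triples than $E(x)$ predicts, that is, $F(x)/E(x)\to\infty$ as $x\to\infty$. Furthermore, one has $\deg p_0=\deg r_0$. (ii) On the other hand, if $\rho_0>1+\frac{1}{\deg r_0}$, then the family does not contain sufficiently many triples to contradict the prediction $E(x)$, that is, $F(x)=o(E(x))$ as $x\to\infty$.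
   Context: Notation. $\Phi_k$ is the $k$-th cyclotomic polynomial. $e(k,D)=2$ if $\sqrt{-D}$ belongs to the field generated over $\mathbb{Q}$ by the $k$-th roots of unity, and $e(k,D)=1$ otherwise. $w_D$ is the number of roots of unity in $\mathbb{Q}(\sqrt{-D})$ and $h_D$ is the class number of $\mathbb{Q}(\sqrt{-D})$. Prediction. $E(x)$ is the heuristically predicted asymptotic value, as $x\to\infty$, of the number of triples $(r,t,y)\in\mathbb{Z}^3$ such that $2\le r\le x$ is a prime dividing $\Phi_k(t-1)$, $y>0$, $t^2+Dy^2=4p$ with $p$ prime, $r$ divides $p+1-t$, and $p\le r^{\rho_0}$. Complete polynomial families. A complete polynomial family for $(k,D)$ is a triple $(r_0,t_0,y_0)$ of polynomials in $\mathbb{Q}[w]$ such that, with $p_0=\frac14(t_0^2+Dy_0^2)$: - $r_0$ and $p_0$ are non-constant, irreducible over $\mathbb{Q}$, and have positive leading coefficients; - in $\mathbb{Q}[w]$, $r_0$ divides $\Phi_k(t_0-1)$ and $r_0$ divides $p_0+1-t_0$; - there are integers $n\ge 1$ and $m$ such that $r_0(nw+m)$, $t_0(nw+m)$, $y_0(nw+m)$, $p_0(nw+m)$ are integers for all $w\in\mathbb{Z}$, and such that no prime $\ell$ divides $r_0(nw+m)\,p_0(nw+m)$ for every $w\in\mathbb{Z}$. Triples belonging to the family. These are the triples $(r,t,y)=(r_0(w_0),t_0(w_0),|y_0(w_0)|)$, where $w_0$ ranges over the integers (positive or negative) for which $r_0(w_0),t_0(w_0),y_0(w_0),p_0(w_0)$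 are all integers and $r_0(w_0)$ and $p_0(w_0)$ are both prime. For such a triple, $p=p_0(w_0)$, so that $t^2+Dy^2=4p$. Statement (BH). Let $f,g\in\mathbb{Q}[w]$ be non-constant polynomials that are irreducible over $\mathbb{Q}$, not proportional to each other, have positive leading coefficients, and take integer values at all integers. Suppose that no prime $\ell$ divides $f(w)g(w)$ for every $w\in\mathbb{Z}$. Then there is a constant $C>0$, depending on $f$ and $g$, such that the number of integers $w_0$ with $2\le w_0\le X$ for which $f(w_0)$ and $g(w_0)$ are both prime is $$(1+o(1))\,\frac{C}{\deg f\,\deg g}\int_2^X\frac{du}{(\log u)^2}\qquad\text{as } X\to\infty.$$
   Formalization: Part (i) is false as stated (BLS12 family: k=12, D=3, r0=w^4-w^2+1, t0=w+1, y0=(w-1)(2w^2-1)/3, rho0=1.2, deg p0=6). The formal part (i) also assumes deg p0/deg r0 <= rho0, which its conclusion deg p0=deg r0 forces. *)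

(* Defs.v *)
From HB Require Import structures.
From mathcomp Require Import all_boot all_order all_algebra all_field.
From mathcomp Require Import finmap.
From mathcomp Require Import all_classical all_reals all_analysis.

Set Implicit Arguments.
Unset Strict Implicit.
Unset Printing Implicit Defensive.

Import Order.TTheory GRing.Theory Num.Theory.
Import numFieldNormedType.Exports.

Local Open Scope classical_set_scope.
Local Open Scope ring_scope.

(* Number of elements of a finite set; an infinite set is sent to 0. *)
Definition ncard (T : choiceType) (A : set T) : nat := #|` fset_set A|%fset.

Definition square_free (D : nat) : Prop :=
  forall d : nat, (d ^ 2 %| D)%N -> d = 1%N.

(* The Landau notations need the bundled form of the filter [+oo]. *)
Definition at_infty {R : realType} : filter_on R :=
  FilterType (pinfty_nbhs R) _.

(** Number fields inside the algebraic numbers *)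

(* A subfield of [algC] contains Q, so this is the field generated over Q. *)
Definition gen_field (X : set algC) : set algC :=
  [set z | forall S : {pred algC},
     divring_closed S -> (forall x, X x -> x \in S) -> z \in S].

Definition cyclotomic_field (k : nat) : set algC :=
  gen_field [set z | z ^+ k = 1].

Definition sqrt_field (D : nat) : set algC :=
  gen_field [set sqrtC (- D%:R)].

Definition e_kD (k D : nat) : nat :=
  if `[< cyclotomic_field k (sqrtC (- D%:R)) >] then 2 else 1.

Definition num_roots_of_unity (D : nat) : nat :=
  ncard [set z | sqrt_field D z /\ exists2 n, (0 < n)%N & z ^+ n = 1].

Definition ring_of_integers (K : set algC) : set algC :=
  [set z | K z /\ z \in Aint].

Definition nonzero_ideal (A I : set algC) : Prop :=
  [/\ I `<=` A, I 0,
      forall x y, I x -> I y -> I (x + y),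
      forall a x, A a -> I x -> I (a * x)
    & exists2 x, I x & x != 0].

Definition ideal_equiv (A I J : set algC) : Prop :=
  exists a b, [/\ A a, A b, a != 0, b != 0 &
    [set a * x | x in I] = [set b * x | x in J]].

Definition ideal_class (A I : set algC) : set (set algC) :=
  [set J | nonzero_ideal A J /\ ideal_equiv A I J].

Definition class_number (D : nat) : nat :=
  let A := ring_of_integers (sqrt_field D) in
  ncard [set ideal_class A I | I in nonzero_ideal A].

(** Polynomials over the rationals *)

Definition deg (f : {poly rat}) : nat := (size f).-1.

Definition evz (f : {poly rat}) (w : int) : rat := f.[w%:~R].

Definition is_prime_rat (x : rat) : Prop := exists2 p : nat, prime p & x = p%:R.

(* [x] is an integer divisible by [l], for [l > 0]. *)
Definition divides_rat (l : nat) (x : rat) : Prop := x / l%:R \is a Num.int.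

Definition no_fixed_prime (u v : int -> rat) : Prop :=
  ~ exists2 l : nat, prime l & forall w : int, divides_rat l (u w * v w).

(** Bateman--Horn for pairs of integer-valued polynomials *)

Section BatemanHorn.
Variable R : realType.

Definition log_integral (X : R) : R :=
  \int[lebesgue_measure]_(u in `[2, X]) ((ln u) ^+ 2)^-1.

Definition bh_count (f g : {poly rat}) (X : R) : R :=
  (ncard [set w : int | [/\ 2 <= (w%:~R : R) <= X,
     is_prime_rat (evz f w) & is_prime_rat (evz g w)]])%:R.

Definition bateman_horn : Prop :=
  forall f g : {poly rat},
    (0 < deg f)%N -> (0 < deg g)%N ->
    irreducible_poly f -> irreducible_poly g ->
    ~~ (f %= g) ->
    0 < lead_coef f -> 0 < lead_coef g ->
    (forall w : int, evz f w \is a Num.int) ->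
    (forall w : int, evz g w \is a Num.int) ->
    no_fixed_prime (evz f) (evz g) ->
    exists2 C : R, 0 < C &
      bh_count f g ~_ at_infty
      (fun X : R => C / ((deg f)%:R * (deg g)%:R) * log_integral X).

End BatemanHorn.

(** Complete polynomial families and the triples belonging to them *)

Definition pol_p (D : nat) (t0 y0 : {poly rat}) : {poly rat} :=
  4^-1 *: (t0 ^+ 2 + D%:R *: y0 ^+ 2).

Definition complete_family (k D : nat) (r0 t0 y0 : {poly rat}) : Prop :=
  let p0 := pol_p D t0 y0 in
  [/\ [/\ (0 < deg r0)%N, irreducible_poly r0 & 0 < lead_coef r0],
      [/\ (0 < deg p0)%N, irreducible_poly p0 & 0 < lead_coef p0],
      r0 %| (map_poly intr 'Phi_k \Po (t0 - 1)),
      r0 %| (p0 + 1 - t0)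
    & exists n m : int, [/\ 1 <= n,
        forall w : int, [/\ evz r0 (n * w + m) \is a Num.int,
          evz t0 (n * w + m) \is a Num.int,
          evz y0 (n * w + m) \is a Num.int
        & evz p0 (n * w + m) \is a Num.int]
      & no_fixed_prime (fun w => evz r0 (n * w + m))
                       (fun w => evz p0 (n * w + m))]].

(* The parameter [w] yields the triple [(r, t, y)]. *)
Definition family_triple (D : nat) (r0 t0 y0 : {poly rat}) (w r t y : int) :
    Prop :=
  [/\ evz r0 w = r%:~R, evz t0 w = t%:~R, `|evz y0 w| = y%:~R,
      is_prime_rat (evz r0 w) & is_prime_rat (evz (pol_p D t0 y0) w)].

Section Counting.
Variable R : realType.

(* A set of triples is counted: distinct parameters giving the same triple
   contribute once. *)
Definition family_count (D : nat) (rho0 : R) (r0 t0 y0 : {poly rat}) (x : R) :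
    R :=
  (ncard [set u : int * int * int | let: (r, t, y) := u in
     exists w : int, [/\ family_triple D r0 t0 y0 w r t y,
       r%:~R <= x & ratr (evz (pol_p D t0 y0) w) <= r%:~R `^ rho0]])%:R.

(* The limit of log p / log r along the family.  If it exceeds [rho0], only
   finitely many members of the family satisfy p <= r ^ rho0. *)
Definition generic_rho (D : nat) (r0 t0 y0 : {poly rat}) : R :=
  (deg (pol_p D t0 y0))%:R / (deg r0)%:R.

Definition predicted_count (k D : nat) (rho0 : R) (x : R) : R :=
  ((e_kD k D)%:R * (num_roots_of_unity D)%:R)
    / (2 * rho0 * (class_number D)%:R)
  * \int[lebesgue_measure]_(u in `[2, x]) (u `^ (2 - rho0) * (ln u) ^+ 2)^-1.

End Counting.

(* Main.v *)
(** Bateman-Horn applied to r0(n w + m) and p0(n w + m) shows that a family with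
    deg p0 = deg r0 = d has about x^(1/d) members with r <= x, up to logarithms;
    for any family the number of integers w with |r0(w)| <= x already bounds the
    count by O(x^(1/d)).  The prediction E(x) has size x^(rho0 - 1), up to
    logarithms, so the comparison of rho0 - 1 with 1/d decides both parts.  The
    logarithms never matter because (log x)^2 = O(x^a) for every a > 0.

    The two polynomials are not proportional: otherwise r0 divides t0 - 1, hence
    (t0 - 1)^k, while it also divides Phi_k(t0 - 1) and thus (t0 - 1)^k - 1.

    For E to be nonzero the class number and the number of roots of unity of
    Q(sqrt(-D)) must be positive.  As infinite sets have cardinality 0 here, this
    amounts to the finiteness of the class group, which follows Hurwitz. *)

Require Import Defs.
From HB Require Import structures.
From mathcomp Require Import all_boot all_order all_algebra all_field.
From mathcomp Require Import finmap.
From mathcomp Require Import all_classical all_reals all_analysis.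
From mathcomp Require Import zify ring lra.

Set Implicit Arguments.
Unset Strict Implicit.
Unset Printing Implicit Defensive.

Import Order.TTheory GRing.Theory Num.Theory.
Import numFieldNormedType.Exports.

Local Open Scope classical_set_scope.
Local Open Scope ring_scope.

(** * The field Q(sqrt(-D)) *)

Lemma finite_int_ball (n : nat) : finite_set [set x : int | (`|x| <= n)%N].
Proof.
apply: (@sub_finite_set _ _ [set (i%:Z - n%:Z) | i in `I_(n.*2.+1)]).
  move=> x /= hx; exists (absz (x + n%:Z)); first by lia.
  by lia.
exact/finite_image/finite_II.
Qed.

Lemma ncard_gt0 (T : choiceType) (A : set T) (x : T) :
  finite_set A -> A x -> (0 < ncard A)%N.
Proof.
move=> fA Ax; rewrite /ncard cardfs_gt0; apply/fset0Pn; exists x.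
by rewrite in_fset_set// inE.
Qed.

(** As a boolean predicate, [gen_field X] can carry the closure structures from which the [rpred]
    lemmas follow; [in_order] does the same for its ring of integers. *)
Definition in_field (X : set algC) : {pred algC} :=
  fun z => `[< gen_field X z >].

Lemma in_field_divring_closed (X : set algC) : divring_closed (in_field X).
Proof.
split=> [|x y|x y].
- by apply/asboolP => S [].
- move=> /asboolP hx /asboolP hy; apply/asboolP => S SS SX.
  by case: (SS) => _ h _; apply: h; [exact: hx|exact: hy].
- move=> /asboolP hx /asboolP hy; apply/asboolP => S SS SX.
  by case: (SS) => _ _ h; apply: h; [exact: hx|exact: hy].
Qed.
HB.instance Definition _ (X : set algC) :=
  GRing.isDivringClosed.Build algC (in_field X) (@in_field_divring_closed X).

Definition in_order (X : set algC) : {pred algC} :=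
  fun z => (z \in in_field X) && (z \in Aint).

Lemma in_order_subring_closed (X : set algC) : subring_closed (in_order X).
Proof.
split=> [|x y /andP[a b] /andP[c d]|x y /andP[a b] /andP[c d]]; apply/andP.
- by rewrite rpred1 Aint1.
- by rewrite !rpredB.
- by rewrite !rpredM.
Qed.
HB.instance Definition _ (X : set algC) :=
  GRing.isSubringClosed.Build algC (in_order X) (@in_order_subring_closed X).

Lemma ring_of_integersE (X : set algC) (z : algC) :
  ring_of_integers (gen_field X) z <-> z \in in_order X.
Proof.
split=> [[Xz iz]|/andP[/asboolP Xz iz]]; last by split.
by apply/andP; split=> //; apply/asboolP.
Qed.

Section QuadraticField.
Variables (D : nat).
Hypothesis D_gt0 : (0 < D)%N.

Notation s := (sqrtC (- D%:R : algC)).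
Notation K := (sqrt_field D).
Notation A := (ring_of_integers K).

Let D_neq0 : D%:R != 0 :> algC. Proof. by rewrite pnatr_eq0 -lt0n. Qed.

Lemma sqr_s : s ^+ 2 = - D%:R. Proof. exact: sqrtCK. Qed.

Lemma natr_disc : D%:R = - s ^+ 2. Proof. by rewrite sqr_s opprK. Qed.

(** Conjugation fixes s^2 = -D, so it sends s to s or to -s; in the first case s would be real and
    -D nonnegative. *)
Lemma conj_s : s^* = - s.
Proof.
have : (s^*) ^+ 2 == s ^+ 2.
  by rewrite -rmorphXn /= sqr_s rmorphN /= rmorph_nat.
rewrite eqf_sqr => /orP[/eqP hs|/eqP //].
have : 0 <= s ^+ 2 by rewrite real_exprn_even_ge0 //; apply/CrealP.
by rewrite sqr_s oppr_ge0 lern0 -leqn0 leqNgt D_gt0.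
Qed.

Lemma conj_ratr (x : rat) : (ratr x : algC)^* = ratr x.
Proof. by rewrite conj_Crat // Crat_rat. Qed.

Lemma conj_quad (x y : rat) :
  (ratr x + ratr y * s : algC)^* = ratr x - ratr y * s.
Proof. by rewrite rmorphD /= conj_ratr rmorphM /= conj_ratr conj_s mulrN. Qed.

Lemma sqnorm_quad (x y : rat) :
  `|ratr x + ratr y * s : algC| ^+ 2 = ratr (x ^+ 2 + D%:R * y ^+ 2).
Proof.
rewrite normCK conj_quad rmorphD rmorphM !rmorphXn /= ratr_nat.
by move: natr_disc; generalize s => t ->; ring.
Qed.

Lemma sqrt_fieldP (z : algC) :
  K z <-> exists x y : rat, z = ratr x + ratr y * s.
Proof.
split=> [Kz|[x [y ->]]].
  pose S : {pred algC} :=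
    [pred z | `[< exists x y : rat, z = ratr x + ratr y * s >]].
  suff /asboolP : z \in S by [].
  apply: Kz => [|t ->]; last first.
    by apply/asboolP; exists 0, 1; rewrite rmorph0 rmorph1; ring.
  split=> [|u v|u v].
  - by apply/asboolP; exists 1, 0; rewrite rmorph0 rmorph1; ring.
  - move=> /asboolP[a [b ->]] /asboolP[c [d ->]]; apply/asboolP.
    by exists (a - c), (b - d); rewrite !rmorphB /=; ring.
  - move=> /asboolP[a [b ->]] /asboolP[c [d ->]]; apply/asboolP.
    pose N : rat := c ^+ 2 + D%:R * d ^+ 2.
    (* A zero divisor must be allowed here; since [0^-1] is 0, the quotient is then 0. Otherwise
       numerator and denominator are multiplied by the conjugate c - d s, which turns the
       denominator into the norm N. *)
    have [cd0|cd_neq0] := eqVneq (ratr c + ratr d * s : algC) 0.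
      by exists 0, 0; rewrite cd0 invr0 mulr0 rmorph0; ring.
    exists ((a * c + D%:R * b * d) / N), ((b * c - a * d) / N).
    have N0 : (ratr c - ratr d * s) * (ratr c + ratr d * s) = ratr N :> algC.
      by rewrite -sqnorm_quad normCKC conj_quad.
    have Nneq : ratr N != 0 :> algC.
      by rewrite -sqnorm_quad sqrf_eq0 normr_eq0.
    apply: (mulIf cd_neq0); rewrite mulfVK //; apply: (mulIf Nneq).
    have NE : ratr N = ratr c ^+ 2 + D%:R * ratr d ^+ 2 :> algC.
      by rewrite /N rmorphD rmorphM !rmorphXn /= ratr_nat.
    have -> : ratr ((a * c + D%:R * b * d) / N)
      = (ratr a * ratr c + D%:R * ratr b * ratr d) / ratr N :> algC.
      by rewrite fmorph_div rmorphD !rmorphM /= ratr_nat.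
    have -> : ratr ((b * c - a * d) / N)
      = (ratr b * ratr c - ratr a * ratr d) / ratr N :> algC.
      by rewrite fmorph_div rmorphB !rmorphM.
    rewrite NE in Nneq *; move: natr_disc Nneq; generalize s => t -> {}Nneq.
    by field.
suff /asboolP : ratr x + ratr y * s \in in_field [set s] by [].
have Ss : s \in in_field [set s] by apply/asboolP => T _; apply.
have Sr (a : rat) : ratr a \in in_field [set s] := rpred_rat _ a.
exact: rpredD (Sr x) (rpredM (Sr y) Ss).
Qed.

Lemma in_order_s : s \in in_order [set s].
Proof.
apply/andP; split; first by apply/asboolP => T _; apply.
apply: (@root_monic_Aint ('X^2 + D%:R%:P)).
- by rewrite rootE !hornerE sqr_s addNr.
- by rewrite monicE lead_coefDl ?lead_coefXn // size_polyXn (leq_ltn_trans (size_polyC_leq1 _)).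
- apply/polyOverP => i; rewrite coefD coefXn coefC; case: ifP => _.
    by rewrite -natrD rpred_nat.
  by rewrite addr0 rpred_nat.
Qed.

Lemma in_order_int (a : int) (X : set algC) : a%:~R \in in_order X.
Proof. exact: rpred_int. Qed.

Lemma in_order_coord (z : algC) : A z ->
  exists a b : int, D.*2%:R * z = a%:~R + b%:~R * s.
Proof.
move=> [/sqrt_fieldP[x [y zE]] iz].
have iz' : z^* \in Aint by rewrite Aint_aut.
have [_ s_int] := andP in_order_s.
have /intrP[a aE] : z + z^* \is a Num.int.
  apply: Cint_rat_Aint; last by rewrite rpredD.
  by rewrite zE conj_quad addrACA subrr addr0 rpredD ?Crat_rat.
have hb : (z - z^*) * s = - (D.*2%:R * ratr y).
  rewrite zE conj_quad -muln2 natrM.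
  by move: natr_disc; generalize s => t ->; ring.
have /intrP[b bE] : (z - z^*) * s \is a Num.int.
  apply: Cint_rat_Aint; last by rewrite rpredM ?rpredB.
  by rewrite hb rpredN rpredM ?Crat_rat ?rpred_nat.
exists (D%:Z * a), (- b); rewrite rmorphN rmorphM /= -aE -bE hb opprK.
rewrite zE conj_quad -pmulrn -muln2 natrM; ring.
Qed.

Lemma sqnorm_nat (z : algC) : A z -> `|z| ^+ 2 \is a Num.nat.
Proof.
move=> [/sqrt_fieldP[x [y zE]] iz].
rewrite natrEint exprn_ge0 // andbT; apply: Cint_rat_Aint.
  by rewrite zE sqnorm_quad Crat_rat.
by rewrite normCK rpredM // Aint_aut.
Qed.

(** A root of unity z is integral of absolute value 1, so 2 D z = a + b s with a^2 + D b^2 = (2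
    D)^2, which bounds a and b. *)
Lemma roots_of_unity_finite :
  finite_set [set z | K z /\ exists2 n, (0 < n)%N & z ^+ n = 1].
Proof.
pose f (p : int * int) : algC := (p.1%:~R + p.2%:~R * s) / D.*2%:R.
pose B := [set x : int | (`|x| <= D.*2)%N].
apply: (@sub_finite_set _ _ [set f p | p in B `*` B]); last first.
  by apply/finite_image/finite_setX; apply: finite_int_ball.
move=> z [Kz [n n_gt0 zn]].
have Az : A z.
  by split=> //; apply: (Aint_unity_root n_gt0); apply/unity_rootP.
have [a [b abE]] := in_order_coord Az.
have D2 : D.*2%:R != 0 :> algC by rewrite pnatr_eq0 double_eq0 -lt0n.
have z1 : `|z| = 1.
  by apply/eqP; rewrite -(@pexpr_eq1 _ _ n) // -normrX zn normr1.
have zn2 : `|D.*2%:R * z| ^+ 2 = D.*2%:R ^+ 2 by rewrite normrM z1 mulr1 normr_nat.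
have /fmorph_inj h : ratr (a%:~R ^+ 2 + D%:R * b%:~R ^+ 2)
    = ratr (D.*2%:R ^+ 2) :> algC.
  by rewrite -sqnorm_quad !ratr_int -abE zn2 rmorphXn /= ratr_nat.
have {}h : a ^+ 2 + D%:Z * b ^+ 2 = D.*2%:Z ^+ 2.
  apply: (@intr_inj rat).
  by rewrite rmorphD rmorphM !rmorphXn /= -!pmulrn.
exists (a, b); last by rewrite /f /= -abE mulrC mulKf.
by split; rewrite /B /=; nia.
Qed.

Lemma num_roots_of_unity_gt0 : (0 < num_roots_of_unity D)%N.
Proof.
apply: (@ncard_gt0 _ _ 1); first exact: roots_of_unity_finite.
split; last by exists 1%N => //; rewrite expr1n.
by move=> S [].
Qed.

End QuadraticField.

(* Pigeonhole on the fractional parts of (i x, i y) for 0 <= i <= (D + 1)^2, which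
   fall into (D + 1)^2 boxes of side 1 / (D + 1). *)
Lemma dirichlet_box (D : nat) : exists2 M : nat, (0 < M)%N &
  forall x y : rat, exists t : nat, exists u v : int,
  [/\ (0 < t <= M)%N &
      (t%:R * x - u%:~R) ^+ 2 + D%:R * (t%:R * y - v%:~R) ^+ 2 < 1].
Proof.
exists (D.+1 ^ 2)%N => // x y.
pose m := D.+1%:R : rat.
have m0 : 0 < m by rewrite ltr0n.
pose c (z : rat) : 'I_D.+1 := inord (Num.truncn (m * (z - (Num.floor z)%:~R))).
have cP (z w : rat) : c z = c w ->
    `|(z - (Num.floor z)%:~R) - (w - (Num.floor w)%:~R)| < m^-1.
  have bnd (a : rat) : 0 <= m * (a - (Num.floor a)%:~R) < m.
    have /andP[h1 h2] := floor_itv a; rewrite intrD in h2.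
    by rewrite pmulr_rge0 // -[X in _ < X]mulr1 ltr_pM2l // subr_ge0 h1 ltrBlDl.
  have cE a : (c a)%:R <= m * (a - (Num.floor a)%:~R) < (c a)%:R + 1.
    have /andP[a0 am] := bnd a.
    (* Thanks to this bound [inord] returns the truncated value and not its default. *)
    have kD : (Num.truncn (m * (a - (Num.floor a)%:~R)) < D.+1)%N.
      by rewrite -(ltr_nat rat) (le_lt_trans _ am) // truncn_le.
    by rewrite /c inordK // natr1 truncn_itv.
  move=> czw; have := cE z; have := cE w; rewrite czw.
  set p := z - _; set q := w - _; move=> /andP[h1 h2] /andP[h3 h4].
  have : `|m * (p - q)| < 1 by rewrite mulrBr ltr_norml; lra.
  by rewrite normrM gtr0_norm // -ltr_pdivlMl // mulr1.
pose f (i : 'I_(D.+1 ^ 2).+1) := (c (i%:R * x), c (i%:R * y)).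
have /injectivePn[i [j ij fij]] : ~~ injectiveb f.
  apply/injectiveP => /leq_card; rewrite card_prod !card_ord.
  by rewrite -mulnn ltnn.
wlog lt_ji : i j ij fij / (j < i)%N.
  move=> hw; have : (i : nat) != j by [].
  by rewrite neq_ltn => /orP[h|h]; [apply: (hw j i)|apply: (hw i j)] => //;
    rewrite eq_sym.
case: fij => /cP hx /cP hy.
exists (i - j)%N.
exists (Num.floor (i%:R * x) - Num.floor (j%:R * x)).
exists (Num.floor (i%:R * y) - Num.floor (j%:R * y)); split.
  by rewrite subn_gt0 lt_ji /= (leq_trans (leq_subr _ _)) // -ltnS.
rewrite natrB ?(ltnW lt_ji) // !rmorphB /=.
set p := _ - _ : rat in hx; set q := _ - _ : rat in hy.
have -> : (i%:R - j%:R) * x - ((Num.floor (i%:R * x))%:~R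
   - (Num.floor (j%:R * x))%:~R) = p :> rat by rewrite /p; ring.
have -> : (i%:R - j%:R) * y - ((Num.floor (i%:R * y))%:~R
   - (Num.floor (j%:R * y))%:~R) = q :> rat by rewrite /q; ring.
have sq (z : rat) : `|z| < m^-1 -> z ^+ 2 < m^-1 ^+ 2.
  by move=> h; rewrite -real_normK ?num_real // ltr_pXn2r // nnegrE ?invr_ge0 ?ltW.
have m1 : m^-1 <= 1 by rewrite invf_le1 // /m -[X in X <= _](mulr1n 1) ler_nat.
have mv : 0 < m^-1 by rewrite invr_gt0.
have mD : m^-1 * (1 + D%:R) = 1 by rewrite -[1 + _](natrD _ 1 D) mulVf ?gt_eqF.
have hD : D%:R * q ^+ 2 <= D%:R * m^-1 ^+ 2 by rewrite ler_wpM2l // ltW // sq.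
(* Both squares are below m^-2, so the sum is below (1 + D) m^-2 = m^-1 <= 1. *)
apply: lt_le_trans (ltr_leD (sq _ hx) hD) _.
suff -> : m^-1 ^+ 2 + D%:R * m^-1 ^+ 2 = m^-1 by [].
transitivity (m^-1 * (m^-1 * (1 + D%:R))); first by ring.
by rewrite mD mulr1.
Qed.

(** * Finiteness of the class number *)

Section ClassNumber.
Variables (D : nat).
Hypothesis D_gt0 : (0 < D)%N.

Notation s := (sqrtC (- D%:R : algC)).
Notation K := (sqrt_field D).
Notation A := (ring_of_integers K).

Lemma in_orderP (z : algC) : A z <-> z \in in_order [set s].
Proof. exact: ring_of_integersE. Qed.

Lemma ideal_equiv_class (I J : set algC) :
  ideal_equiv A I J -> ideal_class A I = ideal_class A J.
Proof.
have imZ (a b : algC) (L : set algC) :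
    [set a * x | x in [set b * x | x in L]] = [set (a * b) * x | x in L].
  by rewrite image_comp; apply: eq_imagel => x _ /=; rewrite mulrA.
have AM a b : A a -> A b -> A (a * b).
  by move=> /in_orderP ha /in_orderP hb; apply/in_orderP; rewrite rpredM.
move=> [a [b [Aa Ab a0 b0 IJ]]]; apply/seteqP; split=> L [idL [c [d [Ac Ad c0 d0 e]]]];
  split=> //.
  exists (c * b), (a * d); split; rewrite ?mulf_neq0 //; [exact: AM..|].
  by rewrite -imZ -IJ imZ -(imZ a d) -e imZ mulrC.
exists (c * a), (b * d); split; rewrite ?mulf_neq0 //; [exact: AM..|].
by rewrite -imZ IJ imZ -(imZ b d) -e imZ mulrC.
Qed.

(** A substitute for Euclidean division: [dirichlet_box], applied to the coordinates of x / y,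
    yields w in Z + Z s such that t x / y - w has norm below 1. The bound M on t depends only on
    D. *)
Lemma hurwitz : exists2 M : nat, (0 < M)%N &
  forall x y : algC, A x -> A y -> y != 0 ->
  exists t : nat, exists w : algC,
  [/\ (0 < t <= M)%N, A w & `|t%:R * x - w * y| ^+ 2 < `|y| ^+ 2].
Proof.
have [M M0 HM] := dirichlet_box D; exists M => // x y [Kx _] [Ky _] y0.
have /(sqrt_fieldP D_gt0)[p [q pqE]] : K (x / y).
  move=> S SS Ss; case: (SS) => _ _ h; apply: h; [exact: Kx|exact: Ky].
have [t [u [v [tM lt1]]]] := HM p q.
exists t, (u%:~R + v%:~R * s); split=> //.
  apply/in_orderP; apply: rpredD; first exact: in_order_int.
  by apply: rpredM; [exact: in_order_int|exact: in_order_s].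
have -> : t%:R * x - (u%:~R + v%:~R * s) * y
   = (ratr (t%:R * p - u%:~R) + ratr (t%:R * q - v%:~R) * s) * y.
  rewrite !rmorphB !rmorphM /= !ratr_nat !ratr_int -[in LHS](divfK y0 x) pqE.
  by ring.
rewrite normrM exprMn (sqnorm_quad D_gt0) gtr_pMl ?exprn_gt0 ?normr_gt0 //.
by rewrite -(rmorph1 (ratr : rat -> algC)) ltr_rat.
Qed.

(* With y of least norm in I and M the bound in [hurwitz], every t x with x in I
   and a suitable t <= M is a multiple of y, so M`! I lies in (y) and J is
   (M`! / y) I. *)
Lemma ideal_reduction : exists2 M : nat, (0 < M)%N &
  forall I, nonzero_ideal A I ->
  exists J, [/\ nonzero_ideal A J, ideal_equiv A I J & J M%:R].
Proof.
have [M M0 HM] := hurwitz; exists M`! => [|I [IA I0 ID IM [x0 Ix0 x0n]]].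
  exact: fact_gt0.
pose P n := `[< exists x, [/\ I x, x != 0 & `|x| ^+ 2 = n%:R] >].
have exP : exists n, P n.
  have /natrP[n nE] := sqnorm_nat D_gt0 (IA _ Ix0).
  by exists n; apply/asboolP; exists x0.
case: (ex_minnP exP) => n /asboolP[y [Iy y0 yn]] minn.
have Ay := IA _ Iy.
have AN (a : algC) : A a -> A (- a).
  by move=> /in_orderP ha; apply/in_orderP; rewrite rpredN.
have Anat (a : nat) : A a%:R by apply/in_orderP; rewrite rpred_nat.
have AM a b : A a -> A b -> A (a * b).
  by move=> /in_orderP ha /in_orderP hb; apply/in_orderP; rewrite rpredM.
have div x : I x -> A (M`!%:R * x / y).
  move=> Ix; have [t [w [/andP[t0 tM] Aw lt_y]]] := HM x y (IA _ Ix) Ay y0.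
  have Iz : I (t%:R * x - w * y) by rewrite -mulNr; apply: ID; apply: IM => //; exact: AN.
  (* The remainder lies in I and is smaller than y, which has least norm among the nonzero elements,
     so it vanishes. *)
  have /eqP : t%:R * x - w * y = 0.
    apply/eqP; apply: contraT => z0.
    have /natrP[k kE] := sqnorm_nat D_gt0 (IA _ Iz).
    have : (n <= k)%N by apply: minn; apply/asboolP; eexists; split; [exact: Iz| |].
    by rewrite leqNgt -(ltr_nat algC) -kE -yn lt_y.
  rewrite subr_eq0 => /eqP txE.
  have /dvdnP[c cE] : (t %| M`!)%N by rewrite dvdn_fact // t0.
  rewrite cE natrM -(mulrA c%:R) txE -!mulrA mulfV // mulr1.
  exact: AM.
exists [set M`!%:R * x / y | x in I]; split.
- split.
  + by move=> _ [x Ix <-]; exact: div.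
  + by exists 0 => //; rewrite mulr0 mul0r.
  + move=> _ _ [x Ix <-] [z Iz <-]; exists (x + z); first exact: ID.
    by rewrite mulrDr mulrDl.
  + move=> a _ Aa [x Ix <-]; exists (a * x); first exact: IM.
    by ring.
  + exists M`!%:R; first by exists y => //; rewrite mulfK.
    by rewrite pnatr_eq0 -lt0n fact_gt0.
- exists M`!%:R, y; split=> //.
  rewrite image_comp; apply: eq_imagel => x _ /=.
  by rewrite [RHS]mulrC divfK.
- by exists y => //; rewrite mulfK.
Qed.

(* Such an ideal J satisfies M (Z + Z s) <= J <= (Z + Z s) / (2 D), so it is the
   preimage of a set of residues modulo 2 D M. *)
Lemma finite_ideals_containing (M : nat) : (0 < M)%N ->
  finite_set [set J | nonzero_ideal A J /\ J M%:R].
Proof.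
move=> M0; pose N := (M * D.*2)%N.
have D2 : (0 < D.*2)%N by rewrite double_gt0.
have D2n : D.*2%:R != 0 :> algC by rewrite pnatr_eq0 -lt0n.
have N0 : (0 < N)%N by rewrite muln_gt0 M0.
pose q (a b : int) : algC := (a%:~R + b%:~R * s) / D.*2%:R.
pose g (T : {set 'I_N * 'I_N}) : set algC :=
  [set z | exists p, exists c d : int,
     p \in T /\ z = q (p.1 : nat) (p.2 : nat) + M%:R * (c%:~R + d%:~R * s)].
apply: (@sub_finite_set _ _ [set g T | T in [set: {set 'I_N * 'I_N}]]); last first.
  exact/finite_image/finite_finset.
move=> J [[JA J0 JD JM _] JMM].
exists (finset (fun p : 'I_N * 'I_N => `[< J (q (p.1 : nat) (p.2 : nat)) >])) => //.
have JMw (c d : int) : J (M%:R * (c%:~R + d%:~R * s)).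
  rewrite mulrC; apply: JM => //; apply/in_orderP; apply: rpredD; first exact: in_order_int.
  by apply: rpredM; [exact: in_order_int|exact: in_order_s].
apply/seteqP; split=> z.
  by move=> [p [c [d [+ ->]]]]; rewrite inE => /asboolP Jp; apply: JD.
move=> Jz; have [a [b abE]] := in_order_coord D_gt0 (JA _ Jz).
have modN (e : int) : (`|(e %% N%:Z)%Z| < N)%N /\ (`|(e %% N%:Z)%Z|%N : int) = (e %% N%:Z)%Z.
  have := ltz_pmod e (N0 : 0 < N%:Z); have := modz_ge0 e (_ : N%:Z != 0).
  by lia.
have [ha aE] := modN a; have [hb bE] := modN b.
(* Reducing a and b modulo N = 2 D M changes z by an element of M (Z + Z s), which is contained in
   J. *)
have zE : z = q `|(a %% N%:Z)%Z|%N `|(b %% N%:Z)%Z|%N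
     + M%:R * ((a %/ N%:Z)%Z%:~R + (b %/ N%:Z)%Z%:~R * s).
  apply: (mulfI D2n); rewrite abE aE bE /q {1}(divz_eq a N%:Z) {1}(divz_eq b N%:Z).
  by rewrite /N !intrD !intrM /= PoszM !intrM -!pmulrn; field.
exists (Ordinal ha, Ordinal hb), (a %/ N%:Z)%Z, (b %/ N%:Z)%Z; split=> //=.
rewrite inE; apply/asboolP => /=.
suff -> : q `|(a %% N%:Z)%Z|%N `|(b %% N%:Z)%Z|%N
   = z + M%:R * ((- (a %/ N%:Z)%Z)%:~R + (- (b %/ N%:Z)%Z)%:~R * s) by exact: JD.
by rewrite [in RHS]zE !intrN; ring.
Qed.

(** By [ideal_reduction] every class contains an ideal containing one fixed M, and there are
    finitely many such ideals; the class of the unit ideal makes the count nonzero. *)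
Lemma class_number_gt0 : (0 < class_number D)%N.
Proof.
apply: (@ncard_gt0 _ _ (ideal_class A A)); last first.
  exists A => //; split=> //.
  - by apply/in_orderP; rewrite rpred0.
  - by move=> x y /in_orderP hx /in_orderP hy; apply/in_orderP; rewrite rpredD.
  - by move=> x y /in_orderP hx /in_orderP hy; apply/in_orderP; rewrite rpredM.
  - by exists 1; [apply/in_orderP; rewrite rpred1|exact: oner_neq0].
have [M M0 HM] := ideal_reduction.
apply: (@sub_finite_set _ _
  [set ideal_class A J | J in [set J | nonzero_ideal A J /\ J M%:R]]).
  move=> _ [I idI <-]; have [J [idJ IJ JM]] := HM I idI.
  by exists J => //; apply/esym/ideal_equiv_class.
exact/finite_image/finite_ideals_containing.
Qed.

End ClassNumber.

(** * The integral in the prediction *)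

Section RealEstimates.
Variable R : realType.
Implicit Types (a b x : R).

Notation weight b := (fun u : R => (u `^ b * (ln u) ^+ 2)^-1).
Notation mu := (@lebesgue_measure R).

(** Since ln y < y for y = x^(a/2), one has ln x = (2/a) ln y <= (2/a) x^(a/2); squaring gives the
    constant (2/a)^2. *)
Lemma sqr_ln_le_powR a : 0 < a ->
  exists2 C : R, 0 < C & forall x, 1 <= x -> (ln x) ^+ 2 <= C * x `^ a.
Proof.
move=> a0; exists ((2 / a) ^+ 2) => [|x x1]; first by rewrite exprn_gt0 ?divr_gt0.
have x0 : 0 < x by rewrite (lt_le_trans _ x1).
have -> : ln x = 2 / a * ln (x `^ (a / 2)) by rewrite ln_powR; field; rewrite gt_eqF.
have -> : x `^ a = (x `^ (a / 2)) ^+ 2.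
  by rewrite -powR_mulrn ?powR_ge0 // -powRrM divfK.
rewrite exprMn ler_pM2l ?exprn_gt0 ?divr_gt0 // lerXn2r ?nnegrE ?powR_ge0 //.
  by rewrite ln_powR mulr_ge0 ?ln_ge0 // divr_ge0 ?ltW.
by rewrite ltW // ln_sublinear // powR_gt0.
Qed.

Lemma continuous_powR_gt0 b x : 0 < x -> {for x, continuous (fun u => u `^ b)}.
Proof.
move=> x0; apply: differentiable_continuous; apply/derivable1_diffP.
by apply: derivable_powR; rewrite in_itv /= x0.
Qed.

Lemma continuous_weight b x : 1 < x -> {for x, continuous (weight b)}.
Proof.
move=> x1; have x0 : 0 < x by rewrite (lt_trans _ x1).
apply: cvgV; first by rewrite mulf_neq0 ?gt_eqF ?powR_gt0 ?exprn_gt0 ?ln_gt0.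
apply: cvgM; first exact: continuous_powR_gt0.
by apply: cvgM; exact: continuous_ln.
Qed.

Lemma integrable_continuous_on (f : R -> R) x :
  (forall u, 2 <= u -> {for u, continuous f}) ->
  mu.-integrable `[2, x] (EFin \o f).
Proof.
move=> cf; apply: continuous_compact_integrable; first exact: segment_compact.
apply: continuous_in_subspaceT => u.
by rewrite inE /= in_itv /= => /andP[u2 _]; exact: cf.
Qed.

Lemma integrable_weight b x : mu.-integrable `[2, x] (EFin \o weight b).
Proof.
apply: integrable_continuous_on => u u2; apply: continuous_weight.
by rewrite (lt_le_trans _ u2) // ltr1n.
Qed.

(** The integrand decreases, so its value at the right end bounds it from below on an interval of
    length x - 2. *)
Lemma weight_integral_ge b x : 0 <= b -> 2 <= x ->
  (x - 2) * weight b x <= \int[mu]_(u in `[2, x]) weight b u.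
Proof.
move=> b0 x2.
have -> : (x - 2) * weight b x = \int[mu]_(u in `[2, x]) weight b x.
  rewrite Rintegral_cst //.
  have -> : fine (mu `[2, x]%classic) = x - 2; last by rewrite mulrC.
  rewrite lebesgue_measure_itv /= lte_fin.
  have [x2'|//] := lerP x 2.
  by rewrite (@le_anti _ _ 2 x) ?x2 ?x2' // subrr.
apply: le_Rintegral => //; last 1 first.
- move=> u /=; rewrite in_itv /= => /andP[u2 ux].
  have u1 : 1 < u by rewrite (lt_le_trans _ u2) // ltr1n.
  have u0 : 0 < u by rewrite (lt_trans _ u1).
  have x1 : 1 < x := lt_le_trans u1 ux.
  have x0 : 0 < x := lt_le_trans u0 ux.
  rewrite lef_pV2 ?posrE ?mulr_gt0 ?powR_gt0 ?exprn_gt0 ?ln_gt0 //.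
  rewrite ler_pM ?powR_ge0 ?sqr_ge0 //.
    by apply: (ge0_ler_powR b0) => //; rewrite nnegrE ltW.
  by rewrite lerXn2r ?nnegrE ?ler_ln ?posrE ?ln_ge0 // ltW.
- by apply: integrable_continuous_on => u _; exact: cvg_cst.
- exact: integrable_weight.
Qed.

(** Replacing ln u by ln 2 loses only logarithms and leaves u^(-b), whose antiderivative is u^(1-b)
    / (1-b). *)
Lemma weight_integral_le b x : 0 < b < 1 -> 2 <= x ->
  \int[mu]_(u in `[2, x]) weight b u
    <= ((1 - b) * (ln 2) ^+ 2)^-1 * x `^ (1 - b).
Proof.
move=> /andP[b0 b1] x2.
have l2 : 0 < ln 2 :> R by rewrite ln_gt0 // ltr1n.
have bb : 0 < 1 - b by rewrite subr_gt0.
pose k : R := ((1 - b) * (ln 2) ^+ 2)^-1.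
have k0 : 0 < k by rewrite invr_gt0 mulr_gt0 // exprn_gt0.
(* The fundamental theorem of calculus is applied below on a nondegenerate interval, so x = 2 is
   treated apart. *)
move: x2; rewrite le_eqVlt => /predU1P[<-|x2].
  by rewrite set_itv1 Rintegral_set1 mulr_ge0 ?powR_ge0 // ltW.
pose f u : R := ((ln 2) ^+ 2)^-1 * u `^ (- b).
pose F u : R := k * u `^ (1 - b).
have cf u : 0 < u -> {for u, continuous f}.
  by move=> u0; apply: cvgM; [exact: cvg_cst|exact: continuous_powR_gt0].
have cF u : 0 < u -> {for u, continuous F}.
  by move=> u0; apply: cvgM; [exact: cvg_cst|exact: continuous_powR_gt0].
have x0 : 0 < x by rewrite (lt_trans _ x2).
have intf : \int[mu]_(u in `[2, x]) f u = F x - F 2.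
  rewrite /Rintegral (@continuous_FTC2 _ f F) //.
  - apply: continuous_in_subspaceT => u.
    rewrite inE /= in_itv /= => /andP[u2 _]; apply: cf.
    by rewrite (lt_le_trans _ u2).
  - split.
    + move=> u; rewrite in_itv /= => /andP[u2 _].
      apply: derivableM; first exact: derivable_cst.
      by apply: derivable_powR; rewrite in_itv /= andbT (lt_trans _ u2).
    + by apply: cvg_at_right_filter; exact: cF.
    + by apply: cvg_at_left_filter; exact: cF.
  - move=> u; rewrite in_itv /= => /andP[u2 _].
    have u0 : 0 < u by rewrite (lt_trans _ u2).
    have du : derivable (fun v : R => v `^ (1 - b)) u 1.
      by apply: derivable_powR; rewrite in_itv /= andbT.
    rewrite /F derive1E deriveM //.
    rewrite derive_cst scaler0 addr0 -derive1E powR_derive1 ?in_itv /= ?u0 //.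
    rewrite /f /k -[_ *: _]/(_ * _) invfM.
    have -> : 1 - b - 1 = - b by ring.
    by field; rewrite !gt_eqF.
apply: (@le_trans _ _ (\int[mu]_(u in `[2, x]) f u)).
  apply: le_Rintegral => //; [exact: integrable_weight| |].
    by apply: integrable_continuous_on => u u2; apply: cf; rewrite (lt_le_trans _ u2).
  move=> u /=; rewrite in_itv /= => /andP[u2 _].
  have u0 : 0 < u by rewrite (lt_le_trans _ u2).
  rewrite /f invfM mulrC powRN ler_pM2r ?invr_gt0 ?powR_gt0 //.
  rewrite lef_pV2 ?posrE ?exprn_gt0 ?ln_gt0 ?(lt_le_trans _ u2) ?ltr1n //.
  by rewrite lerXn2r ?nnegrE ?ln_ge0 ?ler_ln ?posrE ?(le_trans _ u2) ?ler1n.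
by rewrite intf /F lerBlDr lerDl mulr_ge0 ?powR_ge0 // ltW.
Qed.

End RealEstimates.

(** * Growth of polynomials and counting *)

Section PolynomialGrowth.
Variable F : realFieldType.
Implicit Types (p : {poly F}) (v w : F).

Lemma horner_lead_dominates p : 0 < lead_coef p ->
  exists2 W : F, 1 <= W & forall w, W <= `|w| ->
  `|p.[w] - lead_coef p * w ^+ (size p).-1|
    <= lead_coef p / 2 * `|w| ^+ (size p).-1.
Proof.
move=> lc0; have p0 : p != 0 by rewrite -lead_coef_eq0 gt_eqF.
set d := (size p).-1; have sp : size p = d.+1.
  by rewrite /d prednK // lt0n size_poly_eq0.
pose S : F := \sum_(i < d) `|p`_i|.
have S0 : 0 <= S by apply: sumr_ge0.
have SL : 0 <= 2 * S / lead_coef p by rewrite divr_ge0 ?mulr_ge0 // ltW.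
exists (1 + 2 * S / lead_coef p) => [|w Ww]; first by rewrite lerDl.
have w1 : 1 <= `|w| by rewrite (le_trans _ Ww) // lerDl.
have w0 : 0 < `|w| by rewrite (lt_le_trans _ w1).
(* Multiplication by |w| turns the bound S |w|^(d-1) on the lower terms into S |w|^d, which is
   meaningful for d = 0 too. *)
rewrite horner_coef sp big_ord_recr /= lead_coefE -/d addrK -(ler_pM2r w0).
apply: (@le_trans _ _ (S * `|w| ^+ d)).
  rewrite -[X in _ * X](ger0_norm (ltW w0)) -normrM mulr_suml mulr_suml.
  apply: le_trans (ler_norm_sum _ _ _) _; apply: ler_sum => i _.
  rewrite !normrM normr_id normrX -mulrA -exprSr ler_wpM2l //.
  by rewrite ler_weXn2l // ltn_ord.
rewrite mulrAC ler_wpM2r ?exprn_ge0 // -ler_pdivrMl ?divr_gt0 //.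
apply: le_trans Ww; rewrite invf_div -lead_coefE -mulrAC.
by rewrite lerDr.
Qed.

Lemma horner_growth p : 0 < lead_coef p ->
  exists2 W : F, 1 <= W & forall w, W <= `|w| ->
    lead_coef p / 2 * `|w| ^+ (size p).-1 <= `|p.[w]|
    /\ `|p.[w]| <= 2 * lead_coef p * `|w| ^+ (size p).-1.
Proof.
move=> lc0; have [W W1 HW] := horner_lead_dominates lc0.
exists W => // w /HW; set d := (size p).-1; set L := lead_coef p.
have -> : `|w| ^+ d = `|w ^+ d| by rewrite normrX.
move=> h; have h0 : `|L * w ^+ d| = L * `|w ^+ d| by rewrite normrM gtr0_norm.
have := ler_normD (p.[w] - L * w ^+ d) (L * w ^+ d).
have := ler_normB (p.[w]) (p.[w] - L * w ^+ d).
rewrite subrK opprB addrC subrK h0 => h1 h2.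
have := normr_ge0 (w ^+ d); rewrite -/L in lc0; move: h h1 h2; move: `|_| => q.
by move=> h h1 h2 q0; split; nra.
Qed.

Lemma horner_growth_pos p : 0 < lead_coef p ->
  exists2 W : F, 1 <= W & forall w, W <= w ->
    lead_coef p / 2 * w ^+ (size p).-1 <= p.[w]
    /\ p.[w] <= 2 * lead_coef p * w ^+ (size p).-1.
Proof.
move=> lc0; have [W W1 HW] := horner_lead_dominates lc0.
exists W => // w Ww; have w0 : 0 < w by rewrite (lt_le_trans _ Ww) // (lt_le_trans _ W1).
move: (HW w); rewrite (gtr0_norm w0) => /(_ Ww); rewrite ler_norml.
have : 0 <= lead_coef p * w ^+ (size p).-1 by rewrite mulr_ge0 ?exprn_ge0 // ltW.
by move=> h /andP[h1 h2]; split; lra.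
Qed.

(** Passing from exponent k to k + 1 adds w^k (w - 1) - v^k (v - 1), which is nonnegative for 1 <= v
    <= w. *)
Lemma subrX_ge v w n i : 1 <= v -> v <= w -> (i <= n)%N ->
  w ^+ i - v ^+ i <= w ^+ n - v ^+ n.
Proof.
move=> v1 vw /subnK <-; elim: (n - i)%N => // m; rewrite addSn.
move: (m + i)%N => k; move=> /le_trans; apply.
have hk : v ^+ k <= w ^+ k.
  by rewrite lerXn2r ?nnegrE ?(le_trans ler01) // (le_trans v1).
rewrite !exprS; have : 0 <= v ^+ k by rewrite exprn_ge0 // (le_trans ler01).
by move=> vk; nra.
Qed.

(** With d one less than the degree, the lower terms change by at most S (w^d - v^d) and the leading
    one by more than L w (w^d - v^d), where L is the leading coefficient and L w > S. This avoids
    derivatives. *)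
Lemma horner_increasing p : (1 < size p)%N -> 0 < lead_coef p ->
  exists2 W : F, 1 <= W & forall v w, W <= v -> v < w -> p.[v] < p.[w].
Proof.
move=> p1 lc0.
set d := (size p).-2; have sp : size p = d.+2 by rewrite /d; case: (size p) p1 => [|[]].
pose S : F := \sum_(i < d.+1) `|p`_i|.
have S0 : 0 <= S by apply: sumr_ge0.
exists (1 + S / lead_coef p) => [|v w Wv vw]; first by rewrite lerDl divr_ge0 // ltW.
have v1 : 1 <= v by apply: le_trans Wv; rewrite lerDl divr_ge0 // ltW.
have v0 : 0 < v by rewrite (lt_le_trans _ v1).
have w0 : 0 < w by rewrite (lt_trans v0).
rewrite -subr_gt0 !horner_coef sp !(big_ord_recr d.+1) /= opprD addrACA.
rewrite -sumrB -mulrBr.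
have LE : p`_d.+1 = lead_coef p by rewrite lead_coefE sp.
rewrite LE.
under eq_bigr do rewrite -mulrBr.
have hd : 0 <= w ^+ d - v ^+ d.
  by have := subrX_ge v1 (ltW vw) (leq0n d); rewrite !expr0 subrr.
have hS : `|\sum_(i < d.+1) p`_i * (w ^+ i - v ^+ i)| <= S * (w ^+ d - v ^+ d).
  rewrite mulr_suml; apply: le_trans (ler_norm_sum _ _ _) _; apply: ler_sum => i _.
  rewrite normrM ler_wpM2l // ger0_norm; last first.
    by have := subrX_ge v1 (ltW vw) (leq0n i); rewrite !expr0 subrr.
  by apply: subrX_ge => //; [exact: ltW|rewrite -ltnS].
have hL : S < lead_coef p * w.
  rewrite mulrC -ltr_pdivrMr //; apply: lt_trans vw.
  by apply: lt_le_trans Wv; rewrite ltrDr.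
have hW : w * (w ^+ d - v ^+ d) < w ^+ d.+1 - v ^+ d.+1.
  by rewrite !exprS mulrBr ltrD2l ltrN2 ltr_pM2r // exprn_gt0.
move: hS; rewrite ler_norml => /andP[hS _].
have : lead_coef p * (w * (w ^+ d - v ^+ d)) < lead_coef p * (w ^+ d.+1 - v ^+ d.+1).
  by rewrite ltr_pM2l.
have : S * (w ^+ d - v ^+ d) <= lead_coef p * w * (w ^+ d - v ^+ d).
  by rewrite ler_wpM2r // ltW.
rewrite mulrA; lra.
Qed.

End PolynomialGrowth.

Section Cardinals.
Variables (T U : choiceType).

Lemma ncard_le (A B : set T) : finite_set B -> A `<=` B -> (ncard A <= ncard B)%N.
Proof.
move=> fB AB; have fA := sub_finite_set AB fB.
by apply: fsubset_leq_card; rewrite -fset_set_sub.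
Qed.

Lemma ncard_image_le (f : T -> U) (A : set T) :
  finite_set A -> (ncard (f @` A) <= ncard A)%N.
Proof. by move=> fA; rewrite /ncard fset_set_image // leq_imfset_card. Qed.

Lemma ncard_image_inj (f : T -> U) (A : set T) : finite_set A ->
  {in A &, injective f} -> ncard (f @` A) = ncard A.
Proof.
move=> fA injf; rewrite /ncard fset_set_image //; apply/card_in_imfset => x y.
by rewrite !in_fset_set // => xA yA; apply: injf.
Qed.

Lemma ncardU_le (A B : set T) : finite_set A -> finite_set B ->
  (ncard (A `|` B) <= ncard A + ncard B)%N.
Proof. by move=> fA fB; rewrite /ncard fset_setU // cardfsU leq_subr. Qed.

End Cardinals.

Lemma ncard_int_ball_le (n : nat) : (ncard [set x : int | (`|x| <= n)%N] <= n.*2.+1)%N.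
Proof.
have -> : [set x : int | (`|x| <= n)%N] = [set (i%:Z - n%:Z) | i in `I_n.*2.+1].
  apply/seteqP; split=> [x /= hx|_ [i hi <-] /=]; last first.
    by have {}hi : (i < n.*2.+1)%N := hi; lia.
  by exists (absz (x + n%:Z)) => /=; lia.
apply: (leq_trans (ncard_image_le _ _)); first exact: finite_II.
by rewrite /ncard (card_fset_set (card_eqxx _)).
Qed.

(** * Asymptotic bounds *)

Section Asymptotics.
Variable R : realType.

Lemma mulr_powR_cvgy (c a : R) : 0 < c -> 0 < a -> c * x `^ a @[x --> +oo] --> +oo.
Proof.
move=> c0 a0; apply/cvgryPge => A; near=> x.
have A0 : 0 <= `|A| / c by rewrite divr_ge0 // ltW.
apply: le_trans (ler_norm A) _; rewrite -ler_pdivrMl // mulrC.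
have {1}-> : `|A| / c = ((`|A| / c) `^ a^-1) `^ a.
  by rewrite -powRrM mulVf ?gt_eqF // powRr1.
apply: (ge0_ler_powR (ltW a0)); rewrite ?nnegrE ?powR_ge0 //.
Unshelve. all: by end_near.
Qed.

Lemma near_pinfty_mulr_powR (P : R -> Prop) (c a : R) : 0 < c -> 0 < a ->
  (\forall x \near +oo, P x) -> \forall x \near +oo, P (c * x `^ a).
Proof. by move=> c0 a0; exact: mulr_powR_cvgy. Qed.

Lemma log_integralE (x : R) : log_integral x =
  \int[lebesgue_measure]_(u in `[2, x]) (u `^ 0 * ln u ^+ 2)^-1.
Proof. by apply: eq_Rintegral => u _; rewrite powRr0 mul1r. Qed.

(** Used with b = 0 for the logarithmic integral and with b = 2 - rho0 for the prediction. For x >=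
    4 one has x - 2 >= x / 2, and (ln x)^2 costs a factor K x^a. *)
Lemma weight_integral_ge_powR (b a : R) : 0 <= b -> 0 < a ->
  exists2 c : R, 0 < c & \forall x \near +oo, c * x `^ (1 - b - a)
    <= \int[lebesgue_measure]_(u in `[2, x]) (u `^ b * ln u ^+ 2)^-1.
Proof.
move=> b0 a0; have [K K0 HK] := sqr_ln_le_powR a0.
exists (2 * K)^-1; first by rewrite invr_gt0 mulr_gt0.
near=> x.
have x4 : 4 <= x by [].
have x0 : 0 < x by rewrite (lt_le_trans _ x4).
have x1 : 1 < x by rewrite (lt_le_trans _ x4) // ltr1n.
have xb : 0 < x `^ b by exact: powR_gt0.
have xa : 0 < x `^ a by exact: powR_gt0.
have lx : 0 < ln x ^+ 2 by rewrite exprn_gt0 // ln_gt0.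
apply: le_trans (weight_integral_ge b0 _); last by lra.
rewrite !powRB ?(gt_eqF x0) ?implybT // powRr1 ?(ltW x0) //.
rewrite ler_pdivlMr ?(mulr_gt0 xb lx) //.
apply: (@le_trans _ _ ((2 * K)^-1 * (x / x `^ b / x `^ a) * (x `^ b * (K * x `^ a)))).
  rewrite ler_wpM2l ?ler_wpM2l ?HK ?(ltW x1) ?(ltW xb) //.
  by rewrite ltW // ?mulr_gt0 ?invr_gt0 ?mulr_gt0 ?invr_gt0.
have -> : (2 * K)^-1 * (x / x `^ b / x `^ a) * (x `^ b * (K * x `^ a)) = x / 2.
  by field; rewrite (gt_eqF K0) (gt_eqF xa) (gt_eqF xb).
by lra.
Unshelve. all: by end_near.
Qed.

Lemma log_integral_ge (a : R) : 0 < a -> exists2 c : R, 0 < c &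
  \forall x \near +oo, c * x `^ (1 - a) <= log_integral x.
Proof.
move=> a0; have [c c0 Hc] := weight_integral_ge_powR (lexx 0) a0.
exists c => //; apply: filterS Hc => x.
by rewrite subr0 -log_integralE.
Qed.

(** Asymptotic equivalence with error ratio 1/2 already gives half of the main term as a lower
    bound. *)
Lemma bh_count_ge (f g : {poly rat}) (C : R) : 0 < C ->
  bh_count f g ~_ at_infty (fun x : R => C * log_integral x) ->
  forall a : R, 0 < a -> exists2 c : R, 0 < c &
  \forall x \near +oo, c * x `^ (1 - a) <= bh_count f g x.
Proof.
move=> C0 /eqaddoP H a a0; have [c c0 Hc] := log_integral_ge a0.
exists (C / 2 * c); first by rewrite mulr_gt0 // divr_gt0.
have {}H := H 2^-1 _.
near=> x.
have xl : c * x `^ (1 - a) <= log_integral x by near: x.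
have l0 : 0 <= log_integral x by apply: le_trans xl; rewrite mulr_ge0 ?powR_ge0 // ltW.
have : `|bh_count f g x - C * log_integral x| <= 2^-1 * `|C * log_integral x|.
  by near: x; apply: H; rewrite invr_gt0.
rewrite (ger0_norm (mulr_ge0 (ltW C0) l0)) ler_norml => /andP[h _].
apply: (@le_trans _ _ (C / 2 * log_integral x)); last by lra.
by rewrite -mulrA ler_wpM2l // divr_ge0 // ltW.
Unshelve. all: by end_near.
Qed.

(** * The upper bound for the number of triples *)

Lemma ratr_evz (f : {poly rat}) (w : int) :
  ratr (evz f w) = (map_poly (ratr : rat -> R) f).[w%:~R].
Proof. by rewrite /evz -horner_map /= ratr_int. Qed.

Lemma is_prime_rat_ge2 (q : rat) : is_prime_rat q -> 2 <= ratr q :> R.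
Proof. by move=> [p /prime_gt1 p1 ->]; rewrite ratr_nat ler_nat. Qed.

(** At the parameters of interest the three values are integers, so the floors merely convert them
    to [int]. *)
Definition triple_at (r0 t0 y0 : {poly rat}) (w : int) : int * int * int :=
  (Num.floor (evz r0 w), Num.floor (evz t0 w), Num.floor `|evz y0 w|).

Variables (D : nat) (rho : R) (r0 t0 y0 : {poly rat}).
Hypotheses (deg_gt0 : (0 < deg r0)%N) (lc_gt0 : 0 < lead_coef r0).

Definition family_set (x : R) : set (int * int * int) :=
  [set u | let: (r, t, y) := u in exists w : int,
    [/\ family_triple D r0 t0 y0 w r t y,
       r%:~R <= x & ratr (evz (pol_p D t0 y0) w) <= r%:~R `^ rho]].

(** As |r0(w)| grows like |w|^d, the bound r <= x confines w, of either sign, to |w| <= B x^(1/d).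
    Finiteness is recorded as well, because [ncard] sends infinite sets to 0. *)
Lemma family_count_le : exists2 C : R, 0 < C & forall x, 1 <= x ->
  finite_set (family_set x) /\
  family_count D rho r0 t0 y0 x <= C * x `^ (deg r0)%:R^-1.
Proof.
pose p := map_poly (ratr : rat -> R) r0.
have sp : (size p).-1 = deg r0 by rewrite size_map_poly.
have lp : 0 < lead_coef p by rewrite lead_coef_map ltr0q.
have [W W1 HW] := horner_growth lp; rewrite sp in HW.
set L := lead_coef p in lp HW; set d := deg r0 in HW *.
have d_gt0 : (0 < d)%N := deg_gt0.
have L2 : 0 < 2 / L by rewrite divr_gt0.
have Lh : 0 <= L / 2 by rewrite divr_ge0 // ltW.
(* If |w| > B z with z = x^(1/d), the summand W makes the growth estimate applicable and 2 / L makes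
   L / 2 * B exceed 1, so that |r0(w)| > x. *)
pose B := W + 2 / L.
have B1 : 1 <= B by rewrite (le_trans W1) // lerDl ltW.
have BL : 1 < L / 2 * B.
  by rewrite -ltr_pdivrMl ?divr_gt0 // mulr1 invf_div /B ltrDr (lt_le_trans _ W1).
exists (2 * B + 1); first by rewrite addr_gt0 // mulr_gt0 // (lt_le_trans _ B1).
move=> x x1; have x0 : 0 < x by rewrite (lt_le_trans _ x1).
pose z := x `^ d%:R^-1.
have d0 : d%:R != 0 :> R by rewrite pnatr_eq0 -lt0n.
have zd : z ^+ d = x by rewrite -powR_mulrn ?powR_ge0 // -powRrM mulVf // powRr1 // ltW.
have z1 : 1 <= z.
  rewrite leNgt; apply/negP => zl; move: x1; rewrite leNgt -zd => /negP; apply.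
  by rewrite exprn_ilt1 ?powR_ge0 // -lt0n.
have Bz0 : 0 <= B * z by rewrite mulr_ge0 ?(le_trans ler01).
pose N := Num.truncn (B * z).
have sub : family_set x `<=` [set triple_at r0 t0 y0 w | w in [set w : int | (`|w| <= N)%N]].
  move=> [[r t] y] [w [[rE tE yE pr _] rx _]]; exists w; last first.
    by rewrite /triple_at rE tE yE !intrKfloor.
  rewrite /= /N -ltnS -(ltr_nat R) (le_lt_trans _ (truncnS_gt _)) //.
  rewrite natr_absz intr_norm leNgt; apply/negP => wl.
  have wW : W <= `|w%:~R : R|.
    apply: le_trans (ltW wl); rewrite -[W]mulr1 ler_pM ?(le_trans ler01) //.
    by rewrite lerDl ltW.
  have r_ge0 : 0 <= r%:~R :> R.
    have := is_prime_rat_ge2 pr; rewrite rE ratr_int.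
    exact: le_trans.
  have [h _] := HW _ wW; move: h; rewrite -ratr_evz rE ratr_int (ger0_norm r_ge0).
  move=> /le_trans /(_ rx); apply/negP; rewrite -ltNge.
  apply: (@lt_le_trans _ _ (L / 2 * (B * z) ^+ d)); last first.
    by rewrite ler_wpM2l // lerXn2r ?nnegrE // ltW.
  rewrite exprMn zd mulrA ltr_pMl // (lt_le_trans BL) // ler_wpM2l //.
  by rewrite ler_eXnr.
have fin : finite_set [set w : int | (`|w| <= N)%N].
  exact: finite_int_ball.
split; first by apply: sub_finite_set sub _; apply: finite_image.
rewrite /family_count -/(family_set x).
apply: (@le_trans _ _ (N.*2.+1)%:R).
  rewrite ler_nat; apply: leq_trans (ncard_int_ball_le N).
  apply: leq_trans (ncard_image_le (triple_at r0 t0 y0) fin).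
  by apply: ncard_le => //; exact: finite_image.
rewrite -natr1 -muln2 natrM mulrDl mul1r lerD // [_ * 2]mulrC.
by rewrite -[2 * B * _]mulrA ler_wpM2l // truncn_le.
Qed.

End Asymptotics.

(** * Algebra of complete families *)

Section AffineSubstitution.
Variable F : fieldType.
Implicit Types (p q : {poly F}) (a b : F).

Definition affine a b : {poly F} := a *: 'X + b%:P.

Lemma size_affine a b : a != 0 -> size (affine a b) = 2.
Proof.
move=> a0; rewrite size_polyDl size_scale // size_polyX //.
exact: leq_ltn_trans (size_polyC_leq1 _) _.
Qed.

Lemma lead_coef_affine a b : a != 0 -> lead_coef (affine a b) = a.
Proof.
move=> a0; rewrite /affine lead_coefDl ?lead_coefZ ?lead_coefX ?mulr1 //.
rewrite size_scale // size_polyX; exact: leq_ltn_trans (size_polyC_leq1 _) _.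
Qed.

Lemma affineK a b : a != 0 -> affine a b \Po affine a^-1 (- b / a) = 'X.
Proof.
move=> a0; rewrite comp_polyD comp_polyZ comp_polyX comp_polyC /affine scalerDr.
rewrite scalerA mulfV // scale1r -mul_polyC -polyCM mulrC divfK //.
by rewrite polyCN addrNK.
Qed.

Lemma affineVK a b : a != 0 -> affine a^-1 (- b / a) \Po affine a b = 'X.
Proof.
move=> a0; have := affineK (- b / a) (_ : a^-1 != 0); rewrite invr_eq0 => /(_ a0).
have -> : - (- b / a) / a^-1 = b by rewrite invrK -mulNr opprK divfK.
by rewrite invrK.
Qed.

Lemma dvdp_comp_affine a b p q : a != 0 ->
  (p \Po affine a b %| q \Po affine a b) = (p %| q).
Proof.
move=> a0; apply/idP/idP; last exact: dvdp_comp_poly.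
by move/(dvdp_comp_poly (affine a^-1 (- b / a))); rewrite -!comp_polyA affineK // !comp_polyXr.
Qed.

(** The substitution is invertible, so a divisor of the composite comes from a divisor of p of the
    same size. *)
Lemma irreducible_comp_affine a b p : a != 0 ->
  irreducible_poly p -> irreducible_poly (p \Po affine a b).
Proof.
move=> a0 [p1 irr]; split=> [|q q1 qp]; first by rewrite size_comp_poly2 // size_affine.
have qE : q = (q \Po affine a^-1 (- b / a)) \Po affine a b.
  by rewrite -comp_polyA affineVK // comp_polyXr.
move: qp; rewrite qE dvdp_comp_affine // => /irr.
rewrite size_comp_poly2 ?size_affine ?invr_eq0 // => /(_ q1).
by rewrite /eqp !dvdp_comp_affine.
Qed.

End AffineSubstitution.

Lemma evz_comp_affine (f : {poly rat}) (n m w : int) :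
  evz (f \Po affine n%:~R m%:~R) w = evz f (n * w + m).
Proof. by rewrite /evz horner_comp !hornerE /= rmorphD rmorphM. Qed.

(** Nonnegative leading coefficients cannot cancel. *)
Lemma size_addr_nonneg_lead (F : realDomainType) (p q : {poly F}) :
  0 <= lead_coef p -> 0 <= lead_coef q -> (size p <= size (p + q)%R)%N.
Proof.
move=> lp lq; case: (ltngtP (size q) (size p)) => h.
- by rewrite size_polyDl.
- by rewrite addrC size_polyDl // ltnW.
- have [->|p0] := eqVneq p 0; first by rewrite size_poly0.
  have sp : (0 < size p)%N by rewrite size_poly_gt0.
  rewrite leqNgt; apply/negP; rewrite -[X in (_ < X)%N](prednK sp) ltnS.
  move/leq_sizeP/(_ _ (leqnn _)); rewrite coefD -lead_coefE -h -lead_coefE => /eqP.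
  by rewrite paddr_eq0 // lead_coef_eq0 (negPf p0).
Qed.

(** * Degrees and non-proportionality of r0 and p0 *)

Section FamilyDegrees.
Variables (k D : nat) (r0 t0 y0 : {poly rat}).
Let p0 := pol_p D t0 y0.

(** The leading terms of t0^2 and D y0^2 do not cancel, so 2 deg t0 <= deg p0 when t0 is nonzero. *)
Lemma size_trace_lt : (1 < size p0)%N -> (size t0 < size p0)%N.
Proof.
move=> p1; have sq (q : {poly rat}) : 0 <= lead_coef (q ^+ 2).
  by rewrite lead_coef_exp sqr_ge0.
have : (size (t0 ^+ 2)%R <= size p0)%N.
  rewrite /p0 /pol_p size_scale //; apply: size_addr_nonneg_lead => //.
  by rewrite lead_coefZ mulr_ge0.
have [t_eq0|t_neq0] := eqVneq t0 0; first by rewrite t_eq0 size_poly0 => _; exact: ltnW.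
have := size_exp t0 2; have : (0 < size t0)%N by rewrite size_poly_gt0.
by move: p1; move: (size t0) (size (t0 ^+ 2)) (size p0) => a b c; lia.
Qed.

Hypotheses (irr : irreducible_poly r0) (p_gt1 : (1 < size p0)%N).
Hypothesis dvd_p : r0 %| p0 + 1 - t0.

(** As t0 has smaller degree than p0, the multiple p0 + 1 - t0 of r0 is nonzero and has the degree
    of p0. *)
Lemma family_deg_le : (deg r0 <= deg p0)%N.
Proof.
have lt := size_trace_lt p_gt1.
have sE : size (p0 + 1 - t0) = size p0.
  rewrite -addrA size_polyDl // (leq_ltn_trans (size_polyD _ _)) //.
  by rewrite gtn_max size_polyN size_poly1 p_gt1.
have n0 : p0 + 1 - t0 != 0 by rewrite -size_poly_gt0 sE ltnW.
by rewrite /deg -!subn1 leq_sub2r // -sE dvdp_leq.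
Qed.

Lemma dvdp_Cyclotomic : (0 < k)%N ->
  map_poly (intr : int -> rat) 'Phi_k %| 'X^k - 1.
Proof.
move=> k0; have := prod_Cyclotomic k0.
rewrite (bigD1_seq k) ?divisors_id ?divisors_uniq //= => /(congr1 (map_poly (intr : int -> rat))).
rewrite rmorphM rmorphB /= map_polyXn rmorph1 => <-.
exact: dvdp_mulr.
Qed.

Lemma family_not_eqp : (0 < k)%N ->
  r0 %| (map_poly intr 'Phi_k \Po (t0 - 1)) -> ~~ (r0 %= p0).
Proof.
move=> k0 dvd_Phi; apply/negP => /andP[r0p0 _].
have dt : r0 %| t0 - 1.
  by rewrite -dvdpNr opprB -(dvdp_addr _ r0p0) addrA.
have : r0 %| (t0 - 1) ^+ k - 1.
  apply: dvdp_trans dvd_Phi _.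
  have -> : (t0 - 1) ^+ k - 1 = ('X^k - 1) \Po (t0 - 1).
    by rewrite comp_polyB comp_Xn_poly comp_polyC.
  exact/dvdp_comp_poly/dvdp_Cyclotomic.
have dtk : r0 %| (t0 - 1) ^+ k.
  by apply: dvdp_trans dt _; rewrite -{1}(expr1 (t0 - 1)) dvdp_exp2l.
by rewrite (dvdp_subr _ dtk) dvdp1 => /eqP r1; case: irr; rewrite r1.
Qed.

End FamilyDegrees.

(** * Comparison with the prediction *)

(** Parameters counted by Bateman-Horn up to c x^(1/d) satisfy r <= x. Beyond a threshold W they
    also satisfy p <= r^rho and give distinct triples; those below W are absorbed in the constant
    B. *)
Lemma family_count_ge (R : realType) (D : nat) (rho : R)
    (r0 t0 y0 : {poly rat}) (n m : int) :
  let p0 := pol_p D t0 y0 in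
  1 < rho -> (0 < deg r0)%N -> 0 < lead_coef r0 -> 0 < lead_coef p0 ->
  deg p0 = deg r0 -> 0 < n ->
  (forall w : int, [/\ evz r0 (n * w + m) \is a Num.int,
     evz t0 (n * w + m) \is a Num.int & evz y0 (n * w + m) \is a Num.int]) ->
  exists2 c : R, 0 < c & exists B : R, forall x, 1 <= x ->
    bh_count (r0 \Po affine n%:~R m%:~R) (p0 \Po affine n%:~R m%:~R)
        (c * x `^ (deg r0)%:R^-1)
      <= family_count D rho r0 t0 y0 x + B.
Proof.
move=> p0 rho1 d_gt0 lr lp dE n0 intE.
have nq : n%:~R != 0 :> rat by rewrite intr_eq0 gt_eqF.
have nq0 : 0 < n%:~R :> rat by rewrite ltr0z.
set f := r0 \Po _; set g := p0 \Po _.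
have affE := evz_comp_affine.
pose fR := map_poly (ratr : rat -> R) f; pose gR := map_poly (ratr : rat -> R) g.
have d0 : (deg r0)%:R != 0 :> R by rewrite pnatr_eq0 -lt0n.
have sf : (size fR).-1 = deg r0 by rewrite size_map_poly size_comp_poly2 ?size_affine.
have sg : (size gR).-1 = deg r0 by rewrite size_map_poly size_comp_poly2 ?size_affine.
have lf : 0 < lead_coef fR.
  rewrite lead_coef_map ltr0q lead_coef_comp ?size_affine // lead_coef_affine //.
  by rewrite mulr_gt0 // exprn_gt0.
have lg : 0 < lead_coef gR.
  rewrite lead_coef_map ltr0q lead_coef_comp ?size_affine // lead_coef_affine //.
  by rewrite mulr_gt0 // exprn_gt0.
have [W1 W1_ge1 H1] := horner_growth_pos lf.
have [W2 W2_ge1 H2] := horner_growth_pos lg.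
have [W3 W3_ge1 H3] : exists2 W : R, 1 <= W & forall v w, W <= v -> v < w -> fR.[v] < fR.[w].
  by apply: horner_increasing => //; move: sf d_gt0; case: (size fR) => [|[]] // <-.
rewrite sf in H1; rewrite sg in H2.
move: d_gt0 d0 H1 H2; set d := deg r0 => d_gt0 d0 H1 H2.
set L := lead_coef fR in lf H1; set L' := lead_coef gR in lg H2.
(* For w >= W one has p <= q r and r >= Q, so that p <= q r <= r ^ rho. *)
pose q := 4 * L' / L; pose Q := q `^ (rho - 1)^-1.
have q0 : 0 < q by rewrite divr_gt0 ?mulr_gt0.
have Q0 : 0 <= 2 * Q / L by rewrite divr_ge0 ?mulr_ge0 ?powR_ge0 // ltW.
pose W := W1 + W2 + W3 + 2 * Q / L.
have [WW1 WW2 WW3 WWQ] : [/\ W1 <= W, W2 <= W, W3 <= W & 2 * Q / L <= W].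
  by rewrite /W; split; lra.
(* Since c <= 1, c^d <= c, so 2 L (c z)^d <= 2 L c x <= x. *)
pose c := (1 + 2 * L)^-1.
have L20 : 0 < 1 + 2 * L by rewrite addr_gt0 ?mulr_gt0.
have c0 : 0 < c by rewrite invr_gt0.
have c1 : c <= 1 by rewrite invf_le1 // lerDl mulr_ge0 // ltW.
have cL : 2 * L * c <= 1 by rewrite ler_pdivrMr // mul1r lerDr.
exists c => //.
pose N := Num.truncn W; exists (N.*2.+1)%:R => x x1.
have x0 : 0 < x by rewrite (lt_le_trans _ x1).
pose z := x `^ d%:R^-1; pose X := c * z.
have z0 : 0 <= z by exact: powR_ge0.
have zd : z ^+ d = x by rewrite -powR_mulrn // -powRrM mulVf // powRr1 // ltW.
(* Only the finiteness is kept: it makes [ncard] monotone on subsets of [family_set]. *)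
have [C _ /(_ x x1)[fin _]] := @family_count_le R D rho r0 t0 y0 d_gt0 lr.
pose S := [set w : int | [/\ 2 <= (w%:~R : R) <= X,
     is_prime_rat (evz f w) & is_prime_rat (evz g w)]].
pose S' := [set w : int | S w /\ W <= w%:~R].
pose h (w : int) := triple_at r0 t0 y0 (n * w + m).
have Sfin : finite_set S.
  apply: sub_finite_set (finite_int_ball (Num.truncn X)) => w [/andP[w2 wX] _ _] /=.
  have w0 : 0 <= w by rewrite -(ler0z R) (le_trans _ w2).
  rewrite -ltnS -(ltr_nat R).
  by rewrite (le_lt_trans _ (truncnS_gt _)) // pmulrn gez0_abs.
have S'fin : finite_set S' by apply: sub_finite_set Sfin => w [].
pose Bn : set int := [set w : int | (`|w| <= N)%N].
have Bfin : finite_set Bn by exact: finite_int_ball.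
have SS' : S `<=` setU Bn S'.
  move=> w Sw.
  have [wW|wW] := lerP W (w%:~R : R).
    by right; split.
  left.
  move: Sw => [/andP[w2 wX] _ _].
  have w0 : 0 <= w by rewrite -(ler0z R) (le_trans _ w2).
  rewrite /Bn /= -ltnS -(ltr_nat R) (le_lt_trans _ (truncnS_gt _)) //.
  by rewrite pmulrn gez0_abs // ltW.
have fE w : fR.[w%:~R] = ratr (evz r0 (n * w + m)) by rewrite -ratr_evz affE.
have gE w : gR.[w%:~R] = ratr (evz p0 (n * w + m)) by rewrite -ratr_evz affE.
(* Beyond W3 the polynomial [fR] is strictly increasing, so r alone determines w. *)
have hinj : {in S' &, injective h}.
  move=> v w; rewrite !inE => -[_ vW] [_ wW] [+ _ _].
  have [rv _ _] := intE v; have [rw _ _] := intE w.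
  move=> /(congr1 (fun i : int => i%:~R : rat)); rewrite !floorK // => rvw.
  have fvw : fR.[v%:~R] = fR.[w%:~R] by rewrite !fE rvw.
  case: (ltgtP v w) => // [vw|wv].
    by have := H3 v%:~R w%:~R (le_trans WW3 vW); rewrite ltr_int fvw ltxx => /(_ vw).
  by have := H3 w%:~R v%:~R (le_trans WW3 wW); rewrite ltr_int fvw ltxx => /(_ wv).
have hS' : h @` S' `<=` family_set D rho r0 t0 y0 x.
  move=> _ [w [[/andP[w2 wX] prf prg] wW] <-]; exists (n * w + m).
  have [ri ti yi] := intE w.
  have yni : `|evz y0 (n * w + m)| \is a Num.int.
    by have /intrP[j ->] := yi; rewrite -intr_norm.
  have w1 : 1 <= w%:~R :> R by rewrite (le_trans _ w2) // ler1n.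
  have w0 : 0 < w%:~R :> R by rewrite (lt_le_trans _ w1).
  have [f_ge f_le] := H1 _ (le_trans WW1 wW).
  have [_ g_le] := H2 _ (le_trans WW2 wW).
  have rE : (Num.floor (evz r0 (n * w + m)))%:~R = fR.[w%:~R].
    by rewrite fE -[in RHS](floorK ri) ratr_int.
  split.
  - split; first by rewrite floorK.
    + by rewrite floorK.
    + by rewrite floorK.
    + by rewrite -affE.
    + by rewrite -affE.
  - rewrite rE; apply: le_trans f_le _.
    apply: (@le_trans _ _ (2 * L * X ^+ d)).
      by rewrite ler_wpM2l ?mulr_ge0 ?(ltW lf) // lerXn2r ?nnegrE ?(ltW w0) // mulr_ge0 // ltW.
    rewrite /X exprMn zd mulrA ler_piMl ?(ltW x0) //; apply: le_trans cL.
    by rewrite ler_wpM2l ?mulr_ge0 ?(ltW lf) // ler_iXnr // ltW.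
  - rewrite rE -gE.
    (* Because w <= w^d, the linear threshold 2 Q / L in W suffices for r >= Q. *)
    have wd : w%:~R <= w%:~R ^+ d :> R by rewrite ler_eXnr.
    have Qf : Q <= fR.[w%:~R].
      apply: le_trans f_ge; rewrite mulrAC ler_pdivlMr // mulrC [L * _]mulrC -ler_pdivrMr //.
      by rewrite (le_trans WWQ) // (le_trans wW).
    have f0 : 0 < fR.[w%:~R].
      by apply: lt_le_trans f_ge; rewrite mulr_gt0 ?divr_gt0 // exprn_gt0.
    have -> : rho = 1 + (rho - 1) by ring.
    rewrite powRD ?(gt_eqF f0) ?implybT // powRr1 ?(ltW f0) //.
    have qf : q <= fR.[w%:~R] `^ (rho - 1).
      have rho0 : 0 < rho - 1 by rewrite subr_gt0.
      have -> : q = Q `^ (rho - 1) by rewrite /Q -powRrM mulVf ?gt_eqF // powRr1 // ltW.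
      by apply: (ge0_ler_powR (ltW rho0)); rewrite ?nnegrE ?powR_ge0 // ltW.
    apply: le_trans g_le _; apply: (@le_trans _ _ (fR.[w%:~R] * q)); last first.
      by rewrite ler_wpM2l // ltW.
    have -> : 2 * L' * w%:~R ^+ d = L / 2 * w%:~R ^+ d * q.
      by rewrite /q; field; rewrite gt_eqF.
    by rewrite ler_wpM2r // ltW.
rewrite /bh_count -/S /family_count -/(family_set D rho r0 t0 y0 x) -natrD ler_nat addnC.
apply: (@leq_trans (ncard (setU Bn S'))).
  by apply: ncard_le => //; rewrite finite_setU.
apply: leq_trans (ncardU_le Bfin S'fin) _; rewrite leq_add ?ncard_int_ball_le //.
by rewrite -(ncard_image_inj S'fin hinj) ncard_le.
Qed.

(** In (i), the condition [generic_rho <= rho0] discards the families with deg p0 > deg r0. When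
    rho0 < 1 + 1 / deg r0, such a family has only finitely many members with p <= r^rho0, so F stays
    bounded while E tends to infinity. *)
Theorem theorem3p1 (R : realType) (BH : bateman_horn R)
    (k D : nat) (hk : (3 <= k)%N) (hD : (1 <= D)%N) (sqfD : square_free D)
    (rho0 : R) (rho0_gt1 : 1 < rho0) (rho0_lt2 : rho0 < 2)
    (r0 t0 y0 : {poly rat}) (fam : complete_family k D r0 t0 y0) :
  let p0 := pol_p D t0 y0 in
  let F := family_count D rho0 r0 t0 y0 in
  let E := predicted_count k D rho0 in
  (rho0 < 1 + (deg r0)%:R^-1 ->
   generic_rho R D r0 t0 y0 <= rho0 ->
     F x / E x @[x --> +oo] --> +oo /\ deg p0 = deg r0)
  /\
  (1 + (deg r0)%:R^-1 < rho0 -> F =o_ at_infty E).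
Proof.
move=> p0 F E.
have [[dr irr_r lr] [dp irr_p lp] dPhi dp1 [n [m [n1 fint nofix]]]] := fam.
rewrite -/p0 in dp irr_p lp dp1 fint nofix.
set d := deg r0.
have d0 : 0 < d%:R :> R by rewrite ltr0n.
have b01 : 0 < 2 - rho0 < 1 by apply/andP; split; lra.
have k0 : (0 < k)%N by rewrite (leq_trans _ hk).
pose K : R := ((e_kD k D)%:R * (num_roots_of_unity D)%:R)
    / (2 * rho0 * (class_number D)%:R).
have K0 : 0 < K.
  rewrite divr_gt0 // ?mulr_gt0 ?ltr0n ?num_roots_of_unity_gt0 ?class_number_gt0 //.
    by rewrite /e_kD; case: ifP.
  by rewrite (lt_trans _ rho0_gt1).
have EE x : E x = K * \int[lebesgue_measure]_(u in `[2, x])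
    (u `^ (2 - rho0) * (ln u) ^+ 2)^-1 by [].
have E_gt0 x : 2 < x -> 0 < E x.
  move=> x2; rewrite EE mulr_gt0 //.
  apply: lt_le_trans (weight_integral_ge _ (ltW x2)); last by case/andP: b01 => /ltW.
  have x1 : 1 < x by rewrite (lt_trans _ x2) // ltr1n.
  rewrite mulr_gt0 ?subr_gt0 // invr_gt0 mulr_gt0 ?powR_gt0 ?exprn_gt0 ?ln_gt0 //.
  by rewrite (lt_trans _ x1).
split=> [rho_small gen|rho_big].
- have pgt1 : (1 < size p0)%N by move: dp; rewrite /deg; case: (size p0) => [|[]].
  (* Here deg p0 <= rho0 d < d + 1, and [family_deg_le] gives the other inequality. *)
  have dE : deg p0 = deg r0.
    apply/eqP; rewrite eqn_leq (family_deg_le pgt1 dp1) andbT -ltnS.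
    have := le_lt_trans gen rho_small; rewrite /generic_rho -/p0 -/d ltr_pdivrMr //.
    by rewrite mulrDl mul1r mulVf ?gt_eqF // natr1 ltr_nat.
  split=> //.
  pose f := r0 \Po affine n%:~R m%:~R; pose g := p0 \Po affine n%:~R m%:~R.
  have nz : 0 < n by rewrite (lt_le_trans _ n1).
  have nq : n%:~R != 0 :> rat by rewrite intr_eq0 gt_eqF.
  have nq0 : 0 < n%:~R :> rat by rewrite ltr0z.
  have lcc (q : {poly rat}) : 0 < lead_coef q -> 0 < lead_coef (q \Po affine n%:~R m%:~R).
    move=> q0; rewrite lead_coef_comp ?size_affine // lead_coef_affine //.
    by rewrite mulr_gt0 // exprn_gt0.
  have degc (q : {poly rat}) : deg (q \Po affine n%:~R m%:~R) = deg q.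
    by rewrite /deg size_comp_poly2 // size_affine.
  have [C C0 HC] : exists2 C : R, 0 < C &
      bh_count f g ~_ at_infty
      (fun X : R => C / ((deg f)%:R * (deg g)%:R) * log_integral X).
    apply: BH; rewrite ?degc ?lcc //.
    - exact: irreducible_comp_affine.
    - exact: irreducible_comp_affine.
    - by rewrite /eqp !dvdp_comp_affine //; exact: (family_not_eqp irr_r dp1 k0 dPhi).
    - by move=> w; rewrite evz_comp_affine; case: (fint w).
    - by move=> w; rewrite evz_comp_affine; case: (fint w).
    - move=> [l pl H]; apply: nofix; exists l => // w.
      by have := H w; rewrite !evz_comp_affine.
  have C1 : 0 < C / ((deg f)%:R * (deg g)%:R).
    by rewrite divr_gt0 // mulr_gt0 // ltr0n degc // dE.
  have intE w : [/\ evz r0 (n * w + m) \is a Num.int,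
     evz t0 (n * w + m) \is a Num.int & evz y0 (n * w + m) \is a Num.int].
    by case: (fint w).
  have [c c0 [B HB]] := family_count_ge rho0_gt1 dr lr lp dE nz intE.
  (* F grows at least like x^e and E at most like x^(e - del / 2). *)
  pose del : R := d%:R^-1 - (rho0 - 1).
  have del0 : 0 < del / 2 by rewrite divr_gt0 // /del; lra.
  (* The exponent loss is scaled by d because the count is evaluated at c x^(1/d): (x^(1/d))^(1 - d
     del / 2) = x^e. *)
  have [c1 c10 Hc1] := bh_count_ge C1 HC (mulr_gt0 del0 d0).
  pose e := d%:R^-1 - del / 2; pose c2 := c1 * c `^ (1 - del / 2 * d%:R).
  have eE : e = rho0 - 1 + del / 2 by rewrite /e /del; lra.
  have e0 : 0 < e by rewrite eE addr_gt0 // subr_gt0.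
  have c20 : 0 < c2 / 2 by rewrite divr_gt0 // mulr_gt0 // powR_gt0.
  have F_ge : \forall x \near +oo, c2 * x `^ e <= F x + B.
    near=> x.
    have x1 : 1 <= x by [].
    apply: le_trans (HB x x1).
    have : c1 * (c * x `^ d%:R^-1) `^ (1 - del / 2 * d%:R)
        <= bh_count f g (c * x `^ d%:R^-1).
      by near: x; apply: (near_pinfty_mulr_powR c0 _ Hc1); rewrite invr_gt0.
    rewrite powRM ?powR_ge0 ?(ltW c0) // -powRrM mulrA.
    suff -> : d%:R^-1 * (1 - del / 2 * d%:R) = e by [].
    by rewrite /e; field; rewrite gt_eqF.
  pose M : R := K * ((1 - (2 - rho0)) * (ln 2) ^+ 2)^-1.
  have E_le x : 2 <= x -> E x <= M * x `^ (rho0 - 1).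
    move=> x2; rewrite EE /M -mulrA ler_wpM2l ?(ltW K0) //.
    apply: le_trans (weight_integral_le b01 x2) _.
    by have -> : 1 - (2 - rho0) = rho0 - 1 by ring.
  (* One half of c2 x^e will dominate |A| E(x), the other half the constant |B|. *)
  apply/cvgryPge => A; near=> x.
  have x2 : 2 < x by [].
  have x0 : 0 < x by rewrite (lt_trans _ x2).
  rewrite ler_pdivlMr ?E_gt0 //.
  apply: (@le_trans _ _ (`|A| * (M * x `^ (rho0 - 1)))).
    apply: (@le_trans _ _ (`|A| * E x)); first by rewrite ler_wpM2r ?ler_norm // ltW // E_gt0.
    by rewrite ler_wpM2l // E_le // ltW.
  have h1 : c2 * x `^ e <= F x + B by near: x.
  have h2 : `|A| * M <= c2 / 2 * x `^ (del / 2).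
    by near: x; move/cvgryPge : (mulr_powR_cvgy c20 del0); exact.
  have h3 : `|B| <= c2 / 2 * x `^ e.
    by near: x; move/cvgryPge : (mulr_powR_cvgy c20 e0); exact.
  have h4 : `|A| * (M * x `^ (rho0 - 1)) <= c2 / 2 * x `^ e.
    rewrite eE (@powRD _ _ _ (del / 2)) ?(gt_eqF x0) ?implybT // [x `^ _ * _]mulrC.
    by rewrite mulrA [in leRHS]mulrA ler_wpM2r // powR_ge0.
  have := ler_norm B; lra.
- have [C C0 HC] := family_count_le D rho0 t0 y0 dr lr.
  (* Half of the gap [del] pays for the logarithms in E; the other half remains as the factor x^(del
     / 2) by which E exceeds the bound C x^(1/d) on F. *)
  pose del : R := rho0 - 1 - d%:R^-1.
  have del0 : 0 < del / 2 by rewrite divr_gt0 // /del; lra.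
  have [c c0 Hc] : exists2 c : R, 0 < c &
    \forall x \near +oo, c * x `^ (d%:R^-1 + del / 2) <= E x.
    have b0 : 0 <= 2 - rho0 by case/andP: b01 => /ltW.
    have [c c0 Hc] := weight_integral_ge_powR b0 del0.
    exists (K * c); first exact: mulr_gt0.
    apply: filterS Hc => x h; rewrite EE -mulrA ler_wpM2l ?(ltW K0) //.
    apply: le_trans h; rewrite ler_wpM2l ?(ltW c0) //.
    suff -> : d%:R^-1 + del / 2 = 1 - (2 - rho0) - del / 2 by [].
    by rewrite /del; lra.
  apply/eqoP => eps eps0; have ec0 : 0 < eps * c by rewrite mulr_gt0.
  near=> x.
  have x2 : 2 < x by [].
  have x0 : 0 < x by rewrite (lt_trans _ x2).
  have x1 : 1 <= x by rewrite (le_trans _ (ltW x2)) // ler1n.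
  rewrite (gtr0_norm (E_gt0 x x2)) ger0_norm ?ler0n //.
  have [_ /le_trans] := HC x x1; apply.
  have h1 : c * x `^ (d%:R^-1 + del / 2) <= E x by near: x.
  have h2 : C <= eps * c * x `^ (del / 2).
    by near: x; move/cvgryPge : (mulr_powR_cvgy ec0 del0); exact.
  apply: (@le_trans _ _ (eps * (c * x `^ (d%:R^-1 + del / 2)))); last first.
    by rewrite ler_wpM2l // ltW.
  rewrite powRD ?(gt_eqF x0) ?implybT // [x `^ _ * _]mulrC !mulrA.
  by rewrite ler_wpM2r // powR_ge0.
Unshelve. all: by end_near.
Qed.
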